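(* Let $\mathbb{K}$ be a field of characteristic $0$, let $n\geq 2$ be an integer, and let $J,J'\in Mat(n,\mathbb{K})$. The Lie algebras $\left(Mat(n,\mathbb{K}),[\cdot,\cdot]_J\right)$ and $\left(Mat(n,\mathbb{K}),[\cdot,\cdot]_{J'}\right)$ are isomorphic if and only if the matrices $J$ and $J'$ are equivalent.
   Context: $Mat(n,\mathbb{K})$ is the space of $n\times n$ matrices over $\mathbb{K}$. For $J\in Mat(n,\mathbb{K})$, the Lie bracket $[\cdot,\cdot]_J$ on $Mat(n,\mathbb{K})$ is $[A,B]_J=AJB-BJA$. Two matrices $J,J'\in Mat(n,\mathbb{K})$ are called equivalent if there exist $P,Q\in GL(n,\mathbb{K})$ with $J=QJ'P$. *)

(* Defs.v *)
From HB Require Import structures.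
From mathcomp Require Import all_boot all_order all_algebra.
From mathcomp Require Import ring.

Set Implicit Arguments.
Unset Strict Implicit.
Unset Printing Implicit Defensive.

Import GRing.Theory.
Local Open Scope ring_scope.

Record lie_algebra (K : fieldType) := LieAlgebra {
  lie_carrier :> lmodType K;
  lie_bracket : lie_carrier -> lie_carrier -> lie_carrier;
  lie_linearl : forall c x y z,
    lie_bracket (c *: x + y) z = c *: lie_bracket x z + lie_bracket y z;
  lie_linearr : forall c x y z,
    lie_bracket x (c *: y + z) = c *: lie_bracket x y + lie_bracket x z;
  lie_alternating : forall x, lie_bracket x x = 0;
  lie_jacobi : forall x y z,
    lie_bracket x (lie_bracket y z) + lie_bracket y (lie_bracket z x)
      + lie_bracket z (lie_bracket x y) = 0
}.

Definition lie_isomorphic (K : fieldType) (L L' : lie_algebra K) : Prop :=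
  exists f : {linear L -> L'},
    bijective f /\
    forall x y : L, f (lie_bracket x y) = lie_bracket (f x) (f y).

Section MatrixLie.

Variables (K : fieldType) (n : nat) (J : 'M[K]_n).

Definition mx_bracket (A B : 'M[K]_n) : 'M[K]_n :=
  A *m J *m B - B *m J *m A.

Fact mx_bracket_linearl c A B C :
  mx_bracket (c *: A + B) C = c *: mx_bracket A C + mx_bracket B C.
Proof.
rewrite /mx_bracket !mulmxDl mulmxDr -!scalemxAl -scalemxAr scalerBr opprD.
by rewrite addrACA.
Qed.

Fact mx_bracket_alternating A : mx_bracket A A = 0.
Proof. exact: subrr. Qed.

Fact mx_bracketC A B : mx_bracket A B = - mx_bracket B A.
Proof. by rewrite /mx_bracket opprB. Qed.

Fact mx_bracket_linearr c A B C :
  mx_bracket A (c *: B + C) = c *: mx_bracket A B + mx_bracket A C.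
Proof.
by rewrite mx_bracketC mx_bracket_linearl opprD -scalerN -!mx_bracketC.
Qed.

Fact mx_bracket_jacobi A B C :
  mx_bracket A (mx_bracket B C) + mx_bracket B (mx_bracket C A)
    + mx_bracket C (mx_bracket A B) = 0.
Proof.
rewrite /mx_bracket !mulmxBr !mulmxBl !mulmxA !opprB.
set a := A *m J *m B *m J *m C; set b := A *m J *m C *m J *m B.
set c := B *m J *m C *m J *m A; set d := B *m J *m A *m J *m C.
set e := C *m J *m A *m J *m B; set g := C *m J *m B *m J *m A.
apply/matrixP=> i j; rewrite !mxE.
move: (a i j) (b i j) (c i j) (d i j) (e i j) (g i j) => {}a {}b {}c {}d {}e {}g.
ring.
Qed.

Definition mx_lie : lie_algebra K :=
  LieAlgebra mx_bracket_linearl mx_bracket_linearr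
    mx_bracket_alternating mx_bracket_jacobi.

End MatrixLie.

Definition mx_equivalent (K : fieldType) (n : nat) (J J' : 'M[K]_n) : Prop :=
  exists P Q : 'M[K]_n,
    [/\ P \in unitmx, Q \in unitmx & J = Q *m J' *m P].

(* Main.v *)
(** The rank of [J] is recovered from the bracket.  If [J] is singular, the
    centre of the bracket is [{A | A J = J A = 0}], of dimension
    [(n - rank J)^2].  If [J] is invertible, the centre consists of the scalar
    multiples of [J^-1]; in characteristic [0] it contains no nonzero bracket,
    since [A |-> tr (A J)] kills brackets.  If [J] is singular and nonzero, some
    nonzero central element is a bracket, and if [J = 0] everything is central;
    so singular and invertible [J] are distinguished as well. *)
Require Import Defs.
From HB Require Import structures.
From mathcomp Require Import all_boot all_order all_algebra.

Set Implicit Arguments.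
Unset Strict Implicit.
Unset Printing Implicit Defensive.

Import GRing.Theory.
Local Open Scope ring_scope.

Definition mx_central (K : fieldType) (n : nat) (J A : 'M[K]_n) : Prop :=
  forall B : 'M[K]_n, mx_bracket J A B = 0.

Lemma mx_equivalent_rank (K : fieldType) (n : nat) (J J' : 'M[K]_n) :
  mx_equivalent J J' <-> \rank J = \rank J'.
Proof.
split=> [[P [Q [Pu Qu ->]]]|eq_rank].
  by rewrite mxrankMfree ?row_free_unit // eqmxMfull ?row_full_unit.
(* Both matrices factor as [col_ebase], a [pid_mx] of their rank, [row_ebase]. Equal ranks give the
   same middle factor, so only the outer factors are exchanged. *)
exists (invmx (row_ebase J') *m row_ebase J).
exists (col_ebase J *m invmx (col_ebase J')).
split; rewrite ?unitmx_mul ?unitmx_inv ?row_ebase_unit ?col_ebase_unit //.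
rewrite -{2}(mulmx_ebase J') !mulmxA mulmxKV ?col_ebase_unit //.
by rewrite mulmxK ?row_ebase_unit // -eq_rank mulmx_ebase.
Qed.

Lemma inj_linear_mx_leq (K : fieldType) (m1 n1 m2 n2 : nat)
    (g : {linear 'M[K]_(m1, n1) -> 'M[K]_(m2, n2)}) :
  (forall D, g D = 0 -> D = 0) -> (m1 * n1 <= m2 * n2)%N.
Proof.
move=> g0; suff /eqP <- : row_free (lin_mx g) by apply: rank_leq_col.
rewrite -kermx_eq0; apply/eqP/row_matrixP=> i; rewrite row0.
apply: (can_inj vec_mxK); rewrite linear0; apply: g0.
apply: (can_inj mxvecK); rewrite linear0 -mul_vec_lin vec_mxK.
by apply/sub_kermxP; apply: row_sub.
Qed.

Lemma singular_left_kernel (K : fieldType) (n : nat) (J : 'M[K]_n) :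
  J \notin unitmx -> exists2 v : 'rV[K]_n, v != 0 & v *m J = 0.
Proof.
rewrite -row_free_unit -kermx_eq0 => /rowV0Pn[v /sub_kermxP vJ v0].
by exists v.
Qed.

Lemma singular_right_kernel (K : fieldType) (n : nat) (J : 'M[K]_n) :
  J \notin unitmx -> exists2 u : 'cV[K]_n, u != 0 & J *m u = 0.
Proof.
rewrite -unitmx_tr => /singular_left_kernel[v v0 vJ].
by exists v^T; rewrite ?trmx_eq0 // -[J]trmxK -trmx_mul vJ trmx0.
Qed.

Lemma col_row_eq0 (K : fieldType) (m n : nat) (u : 'cV[K]_m) (v : 'rV[K]_n) :
  (u *m v == 0) = (u == 0) || (v == 0).
Proof.
apply/eqP/orP=> [uv|[] /eqP->]; rewrite ?mul0mx ?mulmx0 //.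
case: (eqVneq u 0) => [|/cV0Pn[i ui]]; [by left | right].
apply/eqP/rowP=> k; move/matrixP/(_ i k): uv; rewrite !mxE big_ord1.
by move/eqP; rewrite mulf_eq0 (negPf ui) /= => /eqP.
Qed.

(** Rank-one tests suffice. With [v *m J = 0] and [B] a basis column times [v], the term [B J A]
    vanishes, and [A J B = 0] kills one column of [A J]. A kernel column [u] treats the rows of
    [J A] likewise. *)
Lemma mx_central_singular (K : fieldType) (n : nat) (J A : 'M[K]_n) :
  J \notin unitmx -> mx_central J A -> A *m J = 0 /\ J *m A = 0.
Proof.
move=> Jsing Ac; split.
- have [v v0 vJ] := singular_left_kernel Jsing.
  apply/trmx_inj; rewrite trmx0; apply/row_matrixP=> i.
  rewrite row0 -tr_col; apply/eqP; rewrite trmx_eq0.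
  have /eqP := Ac (delta_mx i 0 *m v).
  rewrite /mx_bracket -[_ *m v *m J]mulmxA vJ mulmx0 mul0mx subr0 mulmxA.
  by rewrite -colE col_row_eq0 (negPf v0) orbF.
- have [u u0 Ju] := singular_right_kernel Jsing.
  apply/row_matrixP=> i; rewrite row0.
  have /eqP := Ac (u *m delta_mx 0 i).
  rewrite /mx_bracket !mulmxA -[A *m J *m u]mulmxA Ju mulmx0 mul0mx sub0r.
  rewrite -!mulmxA -rowE oppr_eq0 col_row_eq0 (negPf u0) /=.
  by move/eqP.
Qed.

Lemma mx_central_kernels (K : fieldType) (n : nat) (J A : 'M[K]_n) :
  A *m J = 0 -> J *m A = 0 -> mx_central J A.
Proof.
by move=> AJ JA B; rewrite /mx_bracket AJ -mulmxA JA mul0mx mulmx0 subrr.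
Qed.

Lemma mx_commute_scalar (K : fieldType) (n : nat) (C : 'M[K]_n) :
  (forall B, C *m B = B *m C) -> exists c : K, C = c%:M.
Proof.
case: n C => [C _|n C comm]; first by exists 0; rewrite [LHS]flatmx0 [RHS]flatmx0.
have Cdelta k i j : C k i = C j j *+ (k == i).
  have /matrixP/(_ k j) := comm (delta_mx i j).
  rewrite !mxE (bigD1 i) //= big1 ?addr0 => [|m /negPf mi]; last first.
    by rewrite mxE mi mulr0.
  rewrite (bigD1 j) //= big1 ?addr0 => [|m /negPf mj]; last first.
    by rewrite mxE mj andbF mul0r.
  by rewrite !mxE !eqxx mulr1 mulr_natl andbT.
by exists (C 0 0); apply/matrixP=> k i; rewrite mxE.
Qed.

(** Centrality tested at [B = 1] gives [A J = J A]; hence [A J] commutes with every [B]. *)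
Lemma mx_central_unit (K : fieldType) (n : nat) (J A : 'M[K]_n) :
  J \in unitmx -> mx_central J A -> exists c : K, A *m J = c%:M.
Proof.
move=> Ju Ac.
have comm B : A *m J *m B = B *m J *m A by apply/subr0_eq; apply: Ac.
apply: mx_commute_scalar => B.
have JA : J *m A = A *m J by rewrite -[LHS]mul1mx mulmxA -comm mulmx1.
by rewrite comm -mulmxA JA.
Qed.

Lemma mxtrace_bracket (K : fieldType) (n : nat) (J A B : 'M[K]_n) :
  \tr (mx_bracket J A B *m J) = 0.
Proof.
rewrite /mx_bracket mulmxBl linearB /=.
by rewrite -(mulmxA _ B) mxtrace_mulC !mulmxA subrr.
Qed.

(** The rows of [U] form a basis of the left kernel, and [R] reads off coordinates in it. *)
Lemma left_kernel_basis (K : fieldType) (m n : nat) (J : 'M[K]_(m, n)) :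
  exists U : 'M[K]_(m - \rank J, m), exists R : 'M[K]_(m, m - \rank J),
  [/\ U *m J = 0, U *m R = 1%:M &
      forall p (A : 'M[K]_(p, m)), A *m J = 0 -> A *m R *m U = A].
Proof.
rewrite -mxrank_ker; set U := row_base (kermx J).
exists U, (pinvmx U); split=> [||p A AJ].
- by apply/sub_kermxP; rewrite eq_row_base.
- exact: mulmxVp (row_base_free _).
- by rewrite mulmxKpV // eq_row_base; apply/sub_kermxP.
Qed.

Lemma right_kernel_basis (K : fieldType) (m n : nat) (J : 'M[K]_(m, n)) :
  exists U : 'M[K]_(n, n - \rank J), exists L : 'M[K]_(n - \rank J, n),
  [/\ J *m U = 0, L *m U = 1%:M &
      forall p (A : 'M[K]_(n, p)), J *m A = 0 -> U *m (L *m A) = A].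
Proof.
have [U [R [UJ UR URK]]] := left_kernel_basis J^T.
move: U R UJ UR URK; rewrite mxrank_tr => U R UJ UR URK.
exists U^T, R^T; split=> [||p A JA].
- by apply: trmx_inj; rewrite trmx_mul trmxK UJ trmx0.
- by rewrite -trmx_mul UR trmx1.
- apply: trmx_inj; rewrite !trmx_mul !trmxK URK //.
  by rewrite -trmx_mul JA trmx0.
Qed.

Lemma mx_bracket_col_row (K : fieldType) (n : nat) (J : 'M[K]_n)
    (u : 'cV[K]_n) (v : 'rV[K]_n) :
  J != 0 -> J *m u = 0 -> exists X Y, mx_bracket J X Y = u *m v.
Proof.
move=> /matrix0Pn[i [j Jij]] Ju.
(* The scaling by the inverse of [J i j] makes the inner factor of [X J Y] equal to 1, while [Y J X]
   contains [J u = 0]. *)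
exists (u *m delta_mx 0 i), ((J i j)^-1 *: delta_mx j 0 *m v).
rewrite /mx_bracket; set q := _ *: _.
have pJq : delta_mx 0 i *m J *m q = 1%:M :> 'M_1.
  apply/matrixP=> a b; rewrite !ord1 /q -scalemxAr -rowE -colE !mxE.
  by rewrite mulVf.
rewrite [X in _ - X](_ : _ = 0) ?subr0.
  by rewrite mulmxA -2!(mulmxA u) pJq mulmx1.
by rewrite mulmxA -(mulmxA (q *m v)) Ju mulmx0 mul0mx.
Qed.

Section BracketIsomorphism.

Variables (K : fieldType) (n : nat) (J J' : 'M[K]_n).
Variables (f : {linear 'M[K]_n -> 'M[K]_n}) (g : 'M[K]_n -> 'M[K]_n).
Hypotheses (fK : cancel f g) (gK : cancel g f).
Hypothesis f_bracket :
  forall A B, f (mx_bracket J A B) = mx_bracket J' (f A) (f B).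

Let f_eq0 A : f A = 0 -> A = 0.
Proof. by move=> fA0; apply: (can_inj fK); rewrite fA0 linear0. Qed.

Lemma mx_central_iso A : mx_central J A -> mx_central J' (f A).
Proof. by move=> Ac B; rewrite -(gK B) -f_bracket Ac linear0. Qed.

Lemma mx_iso_unit :
  [pchar K] =i pred0 -> (2 <= n)%N -> J' \in unitmx -> J \in unitmx.
Proof.
move=> charK0 n_ge2 J'u; apply: contraT => Jsing.
have [J0|Jn0] := eqVneq J 0.
  (* For [J = 0] everything is central, yet this [A] makes [A J'] the matrix unit at position (0,
     1), which is not scalar. *)
  pose A := delta_mx (Ordinal (ltnW n_ge2)) (Ordinal n_ge2) *m invmx J'.
  have Ac : mx_central J' A.
    rewrite -(gK A); apply: mx_central_iso.
    by apply: mx_central_kernels; rewrite J0 ?mulmx0 ?mul0mx.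
  have [c] := mx_central_unit J'u Ac; rewrite /A mulmxKV // => /matrixP.
  move/(_ (Ordinal (ltnW n_ge2)) (Ordinal n_ge2)).
  by rewrite !mxE !eqxx mulr0n => /eqP; rewrite oner_eq0.
have [u u0 Ju] := singular_right_kernel Jsing.
have [v v0 vJ] := singular_left_kernel Jsing.
have [X [Y XY]] := mx_bracket_col_row v Jn0 Ju.
(* The nonzero matrix [u v] is both central and a bracket. Its image times [J'] is therefore a
   scalar matrix [c] of trace zero, so [c n = 0] and characteristic 0 forces [c = 0]. *)
have uvc : mx_central J (u *m v).
  by apply: mx_central_kernels; rewrite ?mulmxA ?Ju -?mulmxA ?vJ ?mul0mx ?mulmx0.
have [c fuv] := mx_central_unit J'u (mx_central_iso uvc).
have := mxtrace_bracket J' (f X) (f Y).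
rewrite -f_bracket XY fuv mxtrace_scalar -mulr_natr => /eqP.
have /pcharf0P char0 := charK0.
rewrite mulf_eq0 char0 (gtn_eqF (ltnW n_ge2)) orbF => /eqP c0.
have /f_eq0/eqP : f (u *m v) = 0.
  by rewrite -(mulmxK J'u (f _)) fuv c0 raddf0 mul0mx.
by rewrite col_row_eq0 (negPf u0) (negPf v0).
Qed.

Lemma mx_iso_rank_singular : J' \notin unitmx -> (\rank J' <= \rank J)%N.
Proof.
move=> J'sing.
have [U1 [R1 [U1J U1R _]]] := left_kernel_basis J.
have [U2 [L2 [JU2 L2U _]]] := right_kernel_basis J.
have [V1 [S1 [_ _ V1K]]] := left_kernel_basis J'.
have [V2 [T2 [_ _ V2K]]] := right_kernel_basis J'.
(* [U2 D U1] is central for [J], and [T2], [S1] take the coordinates of its image in the centre for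
   [J']. Injectivity of [h] thus compares the squares of the two coranks. *)
pose h : {linear _ -> _} :=
  mulmxr S1 \o (mulmx T2 \o (f \o (mulmx U2 \o mulmxr U1))).
have /(@inj_linear_mx_leq _ _ _ _ _ h) : forall D, h D = 0 -> D = 0.
  move=> D /= hD.
  have Ec : mx_central J (U2 *m (D *m U1)).
    apply: mx_central_kernels; first by rewrite -!mulmxA U1J !mulmx0.
    by rewrite mulmxA JU2 mul0mx.
  have [EJ JE] := mx_central_singular J'sing (mx_central_iso Ec).
  have /f_eq0 UDU : f (U2 *m (D *m U1)) = 0.
    by rewrite -[LHS]V2K // -[T2 *m _]V1K ?hD ?mul0mx ?mulmx0 // -mulmxA EJ mulmx0.
  by rewrite -[D]mul1mx -L2U -[_ *m D]mulmx1 -U1R -!mulmxA (mulmxA D)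
    (mulmxA U2) UDU mul0mx mulmx0.
by rewrite !mulnn leq_sqr leq_sub2lE ?rank_leq_row.
Qed.

Lemma mx_iso_rank_leq :
  [pchar K] =i pred0 -> (2 <= n)%N -> (\rank J' <= \rank J)%N.
Proof.
move=> charK0 n_ge2; have [J'u|/mx_iso_rank_singular //] := boolP (J' \in unitmx).
by rewrite (mxrank_unit (mx_iso_unit charK0 n_ge2 J'u)) rank_leq_row.
Qed.

End BracketIsomorphism.

Theorem theorem3p4 (K : fieldType) (charK0 : [pchar K] =i pred0)
    (n : nat) (n_ge2 : (2 <= n)%N) (J J' : 'M[K]_n) :
  lie_isomorphic (mx_lie J) (mx_lie J') <-> mx_equivalent J J'.
Proof.
split=> [[f0 [[g fK gK] f_bracket]]|[P [Q [Pu Qu JE]]]].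
  pose f : {linear 'M[K]_n -> 'M[K]_n} := f0.
  (* The inverse is made linear so that the rank inequality applies in both directions. *)
  pose gL := GRing.isLinear.Build K _ _ _ g (can2_linear fK gK).
  pose g' : {linear 'M[K]_n -> 'M[K]_n} := HB.pack g gL.
  have g_bracket A B : g' (mx_bracket J' A B) = mx_bracket J (g' A) (g' B).
    by apply: (can_inj fK); rewrite gK f_bracket /= !gK.
  apply/mx_equivalent_rank/eqP; rewrite eqn_leq.
  rewrite (mx_iso_rank_leq (f := g') (g := f) gK fK g_bracket) //.
  exact: (mx_iso_rank_leq (f := f) (g := g) fK gK f_bracket).
(* The map is [A] to [P A Q]: substituting [J = Q J' P] turns [P (A J B) Q] into
   [(P A Q) J' (P B Q)]. *)
pose h : {linear 'M[K]_n -> 'M[K]_n} := mulmxr Q \o mulmx P.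
exists h; split=> [|A B].
  exists (fun A => invmx P *m A *m invmx Q) => A /=.
    by rewrite !mulmxA mulVmx // mul1mx mulmxK.
  by rewrite !mulmxA mulmxV // mul1mx mulmxKV.
by rewrite /= /mx_bracket JE mulmxBr mulmxBl !mulmxA.
Qed.
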